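(* Let $\mathcal{E}$ be a finite-dimensional Euclidean space and let $L_i:\mathcal{E}\to\mathcal{E}$ ($i=1,\ldots,n$) be continuous operators such that $\bigcap_{i=1}^n\mathrm{Fix}\,L_i\ne\emptyset$. If all the $L_i$ are quasi-nonexpansive and definable in some $o$-minimal structure, then $L_1,\ldots,L_n$ are jointly Karamata regular (resp. Karamata regular when $n=1$) over any bounded set $B\subseteq\mathcal{E}$. In particular, the corresponding regularity function $\psi_B$ can be taken to be $\Phi(\cdot,r)$ with sufficiently large $r$, where, for $a,b\ge0$ and $\Omega_{a,b}:=\{y\in\mathcal{E}\mid\max_{1\le i\le n}\|y-L_i(y)\|\le a,\ \|y\|\le b\}$, $$\Phi(a,b):=\begin{cases}\max_{y\in\Omega_{a,b}}\mathrm{dist}\big(y,\bigcap_{i=1}^n\mathrm{Fix}\,L_i\big)&\text{if }\Omega_{a,b}\ne\emptyset,\\0&\text{otherwise.}\end{cases}$$ Furthermore, $\Phi(\cdot,r)\in\mathrm{RV}^0_\rho$ with index $\rho\in[0,1]$ when restricted to $(0,1]$ ($\rho$ may depend on $r$).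
   Context: $\mathrm{Fix}\,L=\{x\mid L(x)=x\}$. $L:\mathcal{E}\to\mathcal{E}$ is quasi-nonexpansive if $\|Lx-y\|\le\|x-y\|$ for every $x\in\mathcal{E}$ and $y\in\mathrm{Fix}\,L$. $o$-minimal structure on $(\mathbb{R},+,\cdot)$: a sequence of Boolean algebras $\mathcal{O}_n$ of subsets of $\mathbb{R}^n$ such that for each $n$: (1) $A\in\mathcal{O}_n$ implies $A\times\mathbb{R},\mathbb{R}\times A\in\mathcal{O}_{n+1}$; (2) $\pi(A)\in\mathcal{O}_n$ for all $A\in\mathcal{O}_{n+1}$, where $\pi(x_1,\ldots,x_{n+1})=(x_1,\ldots,x_n)$; (3) $\mathcal{O}_n$ contains every set $\{x\in\mathbb{R}^n\mid p(x)=0\}$ with $p$ a polynomial; (4) the elements of $\mathcal{O}_1$ are exactly the finite unions of intervals and points. Sets in $\mathcal{O}_n$ are called definable; a function $f:\mathbb{R}^n\to\mathbb{R}^m$ is definable if its graph is in $\mathcal{O}_{n+m}$. $\mathcal{E}$ is identified with some $\mathbb{R}^d$ via an orthonormal basis. Regular variation at $0$: a Lebesgue measurable function $f:(0,a]\to(0,\infty)$ belongs to $\mathrm{RV}^0_\rho$ ($\rho\in\mathbb{R}$) if $\lim_{x\to0_+}f(\lambda x)/f(x)=\lambda^\rho$ for all $\lambda>0$. Joint Karamata regularity: operators $L_1,\ldots,L_n:\mathcal{E}\to\mathcal{E}$ with $C:=\bigcap_{i=1}^n\mathrm{Fix}\,L_i\ne\emptyset$ are jointly Karamata regular over a bounded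 set $B$ if there is a function $\psi_B:\mathbb{R}_+\to\mathbb{R}_+$ (a regularity function) such that: (1) $\mathrm{dist}(x,C)\le\psi_B(\max_{1\le i\le n}\|x-L_i(x)\|)$ for all $x\in B$; (2) $\psi_B$ is nondecreasing with $\lim_{t\to0_+}\psi_B(t)=\psi_B(0)=0$; (3) for some $a>0$, $\psi_B|_{(0,a]}\in\mathrm{RV}^0_\rho$ with $\rho\in[0,1]$. For $n=1$ one says ''Karamata regular''.
   Formalization: The claims that Φ(·,r) is a regularity function and lies in RV^0_ρ are stated only when the common fixed-point set is not all of E; otherwise (e.g. all L_i the identity) Φ is identically 0 and not in RV^0_ρ, though joint Karamata regularity is still proved. *)

(* Defs.v *)
From HB Require Import structures.
From mathcomp Require Import all_boot all_order all_algebra.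
From mathcomp Require Import all_classical all_reals all_analysis.
(* mpoly is not imported: its notations clash with those of analysis. *)
From mathcomp Require mpoly.

Set Implicit Arguments.
Unset Strict Implicit.
Unset Printing Implicit Defensive.
Import Order.TTheory GRing.Theory Num.Theory.
Import numFieldNormedType.Exports.
Local Open Scope classical_set_scope.
Local Open Scope ring_scope.

(* For x : 'rV_n.+1, col' ord_max x drops the last coordinate and col' ord0 x
   drops the first one, so the two clauses of omin_prod are A x R and R x A. *)
Record o_minimal (R : realType) (O : forall n, set (set 'rV[R]_n)) : Prop :=
  OMinimal {
    omin_setT : forall n, O n setT ;
    omin_setC : forall n A, O n A -> O n (~` A) ;
    omin_setU : forall n A B, O n A -> O n B -> O n (A `|` B) ;
    omin_prod : forall n A, O n A ->
      O n.+1 [set x | A (col' ord_max x)] /\ O n.+1 [set x | A (col' ord0 x)] ;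
    omin_proj : forall n (A : set 'rV[R]_n.+1), O n.+1 A ->
      O n [set col' ord_max x | x in A] ;
    omin_poly : forall n (p : mpoly.mpoly n R),
      O n [set x | mpoly.meval (fun i => x 0 i) p = 0] ;
    omin_line : forall A : set 'rV[R]_1,
      O 1%N A <-> exists s : seq (interval R),
        A = [set x | exists2 I, I \in s & x 0 0 \in I]
  }.

Definition definable_fun (R : realType) (O : forall n, set (set 'rV[R]_n))
    (n m : nat) (f : 'rV[R]_n -> 'rV[R]_m) : Prop :=
  O (n + m)%N [set z | rsubmx z = f (lsubmx z)].

(* The norm of E is the one induced by the inner product ip. *)
Definition euclidean_norm (R : realType) (E : normedModType R)
    (ip : {dot E for idfun}) : Prop :=
  forall x : E, `|x| = Num.sqrt (ip x x).

Definition orthonormal_basis (R : realType) (E : normedModType R)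
    (ip : {dot E for idfun}) (d : nat) (e : 'I_d -> E) : Prop :=
  (forall i j, ip (e i) (e j) = (i == j)%:R) /\
  (forall x : E, exists c : 'I_d -> R, x = \sum_(i < d) c i *: e i).

(* f is read as a map R^d -> R^d in the coordinates of the orthonormal basis e
   for ip; x |-> (ip x (e j))_j is the coordinate map. *)
Definition definable_operator (R : realType) (E : normedModType R)
    (O : forall n, set (set 'rV[R]_n)) (ip : {dot E for idfun})
    (d : nat) (e : 'I_d -> E) (f : E -> E) : Prop :=
  definable_fun O (fun u : 'rV[R]_d =>
    \row_(j < d) ip (f (\sum_(i < d) u 0 i *: e i)) (e j)).

Definition Fix (T : Type) (f : T -> T) : set T := [set x | f x = x].

Definition quasi_nonexpansive (R : realType) (E : normedModType R)
    (f : E -> E) : Prop :=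
  forall x y, Fix f y -> `|f x - y| <= `|x - y|.

Definition dist (R : realType) (E : normedModType R) (x : E) (A : set E) : R :=
  inf [set `|x - y| | y in A].

Definition common_fix (T : Type) (n : nat) (L : 'I_n -> T -> T) : set T :=
  \bigcap_i Fix (L i).

Definition residual (R : realType) (E : normedModType R) (n : nat)
    (L : 'I_n -> E -> E) (x : E) : R :=
  \big[Num.max/0]_(i < n) `|x - L i x|.

(* Measurability from the Lebesgue (Caratheodory) sigma-algebra to the Borel
   one. *)
Definition lebesgue_measurable_fun (R : realType) (D : set R) (f : R -> R) :
    Prop :=
  @measurable_fun _ _
    (caratheodory_type ((wlength (@idfun R))^*)%mu) (measurableTypeR R) D f.

(* f restricted to (0, a] maps to (0, +oo) and is in RV^0_rho. *)
Definition RV0 (R : realType) (a rho : R) (f : R -> R) : Prop :=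
  [/\ forall x, 0 < x <= a -> 0 < f x,
      lebesgue_measurable_fun `]0, a] f &
      forall lambda, 0 < lambda ->
        f (lambda * x) / f x @[x --> 0^'+] --> lambda `^ rho].

(* psi encodes a map R_+ -> R_+: only its values on [0, +oo) matter. *)
Definition consistent_error_bound (R : realType) (E : normedModType R)
    (n : nat) (L : 'I_n -> E -> E) (B : set E) (psi : R -> R) : Prop :=
  [/\ forall t, 0 <= t -> 0 <= psi t,
      forall x, B x -> dist x (common_fix L) <= psi (residual L x),
      forall s t, 0 <= s -> s <= t -> psi s <= psi t,
      psi t @[t --> 0^'+] --> (0 : R) &
      psi 0 = 0].

Definition regularity_function (R : realType) (E : normedModType R)
    (n : nat) (L : 'I_n -> E -> E) (B : set E) (psi : R -> R) : Prop :=
  consistent_error_bound L B psi /\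
  exists a rho : R, [/\ 0 < a, 0 <= rho <= 1 & RV0 a rho psi].

Definition jointly_Karamata_regular (R : realType) (E : normedModType R)
    (n : nat) (L : 'I_n -> E -> E) (B : set E) : Prop :=
  exists psi : R -> R, regularity_function L B psi.

(* Junk value 0 when S has no maximum. *)
Definition set_max (R : realType) (S : set R) : R := xget 0 (S `&` ubound S).

Definition Omega (R : realType) (E : normedModType R) (n : nat)
    (L : 'I_n -> E -> E) (a b : R) : set E :=
  [set y | residual L y <= a /\ `|y| <= b].

Definition Phi (R : realType) (E : normedModType R) (n : nat)
    (L : 'I_n -> E -> E) (a b : R) : R :=
  if `[< Omega L a b !=set0 >]
  then set_max [set dist y (common_fix L) | y in Omega L a b]
  else 0.

(* Main.v *)
(* Write f = Phi(., r).  It is nondecreasing, and for fixed lam, c > 0 the set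
   of t > 0 with f (lam * t) < c * f t is definable in one variable, hence a
   finite union of intervals, so the inequality is eventually true or eventually
   false as t decreases to 0.  Therefore f (lam * t) / f t has a limit g lam in
   [0, 1] for every lam in (0, 1], with no appeal to the monotonicity theorem.
   Quasi-nonexpansiveness gives residual <= 2 * dist, hence f t >= t / 2 near 0,
   which forces g lam >= lam.  Since g is multiplicative, s |-> - ln (g (e^-s))
   is additive and lies between 0 and s, so g lam = lam `^ rho with
   0 <= rho <= 1. *)
Require Import Defs.
From HB Require Import structures.
From mathcomp Require Import all_boot all_order all_algebra.
From mathcomp Require Import all_classical all_reals all_analysis.
From mathcomp Require Import zify lra.
From mathcomp Require mpoly.
Import (canonicals) mpoly.

Set Implicit Arguments.
Unset Strict Implicit.
Unset Printing Implicit Defensive.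
Import Order.TTheory GRing.Theory Num.Theory.
Import numFieldNormedType.Exports.
Local Open Scope classical_set_scope.
Local Open Scope ring_scope.

(** * Closure properties of definable sets *)

Section Definability.
Context {R : realType} (O : forall n, set (set 'rV[R]_n)) (O_omin : o_minimal O).
Implicit Types (m k : nat) (v : nat -> R) (P Q : (nat -> R) -> Prop).

(** Extension by 0 turns rows of every length into valuations of one type, so formulas with
    different numbers of variables can be combined without casts. *)
Definition env m (x : 'rV[R]_m) (i : nat) : R :=
  if insub i is Some j then x 0 j else 0.

Lemma env_ord m (x : 'rV[R]_m) (j : 'I_m) : env x j = x 0 j.
Proof. by rewrite /env valK. Qed.

Lemma env_out m (x : 'rV[R]_m) i : (m <= i)%N -> env x i = 0.
Proof. by move=> mi; rewrite /env insubN // -leqNgt. Qed.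

Definition upd v m (t : R) (i : nat) : R := if i == m then t else v i.

Definition updv v m k (w : 'rV[R]_k) (i : nat) : R :=
  if (m <= i < m + k)%N then env w (i - m) else v i.

Definition vec k v (a : nat) : 'rV[R]_k := \row_(j < k) v (a + j)%N.

(* A formula in m free variables is a predicate on valuations nat -> R, of
   which only the values at 0, ..., m - 1 matter; a quantifier binds variable
   m, so that the variables already in scope keep their indices. *)
Definition definable m P := O [set x : 'rV[R]_m | P (env x)].

Lemma definable_iff m P Q :
  (forall v, P v <-> Q v) -> definable m P -> definable m Q.
Proof.
move=> PQ; rewrite /definable; congr (O _).
by apply/seteqP; split => x /PQ.
Qed.

Lemma definable_not m P : definable m P -> definable m (fun v => ~ P v).
Proof. exact: omin_setC. Qed.

Lemma definable_or m P Q :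
  definable m P -> definable m Q -> definable m (fun v => P v \/ Q v).
Proof. exact: omin_setU. Qed.

Lemma definable_and m P Q :
  definable m P -> definable m Q -> definable m (fun v => P v /\ Q v).
Proof.
move=> dP dQ; apply: (@definable_iff _ (fun v => ~ (~ P v \/ ~ Q v))).
  by move=> v; rewrite not_orE !notK.
by apply/definable_not/definable_or; exact: definable_not.
Qed.

Lemma definable_imply m P Q :
  definable m P -> definable m Q -> definable m (fun v => P v -> Q v).
Proof.
move=> dP dQ; apply: (@definable_iff _ (fun v => ~ P v \/ Q v)).
  by move=> v; rewrite implyE.
by apply: definable_or => //; exact: definable_not.
Qed.

Lemma definable_true m : definable m (fun=> True).
Proof. exact: omin_setT. Qed.

Lemma definable_forall_fin m (I : finType) (P : I -> (nat -> R) -> Prop) :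
  (forall i, definable m (P i)) -> definable m (fun v => forall i, P i v).
Proof.
move=> dP.
suff H (s : seq I) : definable m (fun v => forall i, i \in s -> P i v).
  apply: definable_iff (H (enum I)) => v; split => Pv i; last by move=> _.
  by apply: Pv; rewrite mem_enum.
elim: s => [|i s IHs]; first by apply: definable_iff (definable_true m).
apply: definable_iff (definable_and (dP i) IHs) => v; split.
  by move=> [Pi Ps] j; rewrite inE => /predU1P[->|/Ps].
by move=> Pv; split=> [|j js]; apply: Pv; rewrite inE ?eqxx ?js ?orbT.
Qed.

Lemma env_upd m (x : 'rV[R]_m.+1) :
  env x = upd (env (col' ord_max x)) m (x 0 ord_max).
Proof.
apply/funext => i; rewrite /upd; case: ltngtP => [im|mi|->].
- rewrite -[i]/(nat_of_ord (Ordinal im)) env_ord mxE.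
  rewrite -env_ord /= /bump; congr (env _ _).
  by rewrite leqNgt im.
- by rewrite !env_out // ltnW.
- by rewrite -[m]/(nat_of_ord (ord_max : 'I_m.+1)) env_ord.
Qed.

(** The existential quantifier over variable [m] is the projection that forgets the last
    coordinate. *)
Lemma definable_exists1 m P : definable m.+1 P ->
  definable m (fun v => exists t, P (upd v m t)).
Proof.
move=> /(omin_proj O_omin); rewrite /definable; congr (O _).
apply/seteqP; split => [_ [x Px <-]|y [t Pt]] /=.
  by exists (x 0 ord_max); rewrite -env_upd.
pose x := \row_(i < m.+1) (if unlift ord_max i is Some j then y 0 j else t).
have xy : col' ord_max x = y by apply/rowP => j; rewrite !mxE liftK.
by exists x => //=; rewrite env_upd xy mxE unlift_none.
Qed.

Lemma definable_existsv_upd m k P : definable (m + k) P ->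
  definable m (fun v => exists w : 'rV[R]_k, P (updv v m w)).
Proof.
elim: k P => [|k IHk] P.
  rewrite addn0; apply: definable_iff => v.
  have E w : updv v m (w : 'rV[R]_0) = v.
    apply/funext => i; rewrite /updv addn0; case: ifP => // /andP[mi].
    by rewrite ltnNge mi.
  by split => [Pv|[w]]; [exists 0; rewrite E|rewrite E].
(* The last variable of the block, number [m + k], is projected away first; the induction hypothesis
   removes the other [k]. *)
rewrite addnS => /definable_exists1 /IHk; apply: definable_iff => v.
have E (w : 'rV[R]_k.+1) :
    upd (updv v m (col' ord_max w)) (m + k) (w 0 ord_max) = updv v m w.
  apply/funext => i; rewrite /upd /updv addnS ltnS env_upd /upd.
  case: (leqP m i) => /= [mi|im].
    have -> : (i - m == k)%N = (i == m + k)%N by rewrite -(eqn_add2l m) subnKC.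
    by rewrite [(i <= _)%N]leq_eqVlt; case: eqP.
  by rewrite ltn_eqF // ltn_addr.
split => [[w [t Pt]]|[w Pw]]; last first.
  by exists (col' ord_max w), (w 0 ord_max); rewrite E.
pose x := \row_(i < k.+1) (if unlift ord_max i is Some j then w 0 j else t).
exists x; rewrite -E mxE unlift_none.
by have -> : col' ord_max x = w by apply/rowP => j; rewrite !mxE liftK.
Qed.

Lemma vec_eq k v v' a m : (a + k <= m)%N ->
  (forall i, (i < m)%N -> v i = v' i) -> vec k v a = vec k v' a.
Proof.
move=> akm vv'; apply/rowP => j; rewrite !mxE; apply: vv'.
by apply: leq_trans akm; rewrite ltn_add2l.
Qed.

(* The locality condition says that Q only looks at the variables below m. *)
Lemma definable_existsv m k (Q : (nat -> R) -> 'rV[R]_k -> Prop) :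
  (forall v v' w, (forall i, (i < m)%N -> v i = v' i) -> Q v w -> Q v' w) ->
  definable (m + k) (fun v => Q v (vec k v m)) ->
  definable m (fun v => exists w, Q v w).
Proof.
move=> Qloc /definable_existsv_upd; apply: definable_iff => v.
have E (w : 'rV[R]_k) : vec k (updv v m w) m = w.
  apply/rowP => j; rewrite mxE /updv leq_addr /= ltn_add2l ltn_ord.
  by rewrite addKn env_ord.
have F (w : 'rV[R]_k) i : (i < m)%N -> updv v m w i = v i.
  by move=> im; rewrite /updv leqNgt im.
split=> [[w H]|[w Qw]]; exists w.
  by move: H; rewrite E; apply: Qloc; exact: F.
by rewrite E; apply: Qloc Qw => i /F.
Qed.

Lemma definable_forallv m k (Q : (nat -> R) -> 'rV[R]_k -> Prop) :
  (forall v v' w, (forall i, (i < m)%N -> v i = v' i) -> Q v w -> Q v' w) ->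
  definable (m + k) (fun v => Q v (vec k v m)) ->
  definable m (fun v => forall w, Q v w).
Proof.
move=> Qloc dQ; apply: (@definable_iff _ (fun v => ~ exists w, ~ Q v w)).
  move=> v; split=> [nex w|Qw [w]]; last exact.
  by apply: contrapT => nQ; apply: nex; exists w.
apply/definable_not/definable_existsv; last exact: definable_not.
by move=> v v' w vv' nQ Qw; apply: nQ; apply: Qloc Qw => i /vv'.
Qed.

(* Quantifying over m' allows the use of f under further quantifiers. *)
Definition polyfun m (f : (nat -> R) -> R) := forall m', (m <= m')%N ->
  exists p : mpoly.mpoly m' R,
    forall v, f v = mpoly.meval (fun i => v (nat_of_ord i)) p.

Lemma polyfunC m c : polyfun m (fun=> c).
Proof.
by move=> m' _; exists (mpoly.mpolyC m' c) => v; rewrite mpoly.mevalC.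
Qed.

Lemma polyfunX m i : (i < m)%N -> polyfun m (fun v => v i).
Proof.
move=> im m' mm'; exists (mpoly.mpolyX R (mpoly.mnm1 (Ordinal (leq_trans im mm')))).
by move=> v; rewrite mpoly.mevalXU.
Qed.

Lemma polyfun_vec m k a (j : 'I_k) : (a + k <= m)%N ->
  polyfun m (fun v => vec k v a 0 j).
Proof.
move=> akm; rewrite (_ : (fun v => _) = fun v => v (a + j)%N).
  by apply: polyfunX; apply: leq_trans akm; rewrite ltn_add2l.
by apply/funext => v; rewrite mxE.
Qed.

Lemma polyfunD m f g : polyfun m f -> polyfun m g -> polyfun m (fun v => f v + g v).
Proof.
move=> pf pg m' mm'; have [p fE] := pf _ mm'; have [q gE] := pg _ mm'.
by exists (p + q) => v; rewrite mpoly.mevalD fE gE.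
Qed.

Lemma polyfunM m f g : polyfun m f -> polyfun m g -> polyfun m (fun v => f v * g v).
Proof.
move=> pf pg m' mm'; have [p fE] := pf _ mm'; have [q gE] := pg _ mm'.
by exists (p * q) => v; rewrite mpoly.mevalM fE gE.
Qed.

Lemma polyfunB m f g : polyfun m f -> polyfun m g -> polyfun m (fun v => f v - g v).
Proof.
move=> pf pg m' mm'; have [p fE] := pf _ mm'; have [q gE] := pg _ mm'.
by exists (p - q) => v; rewrite mpoly.mevalB fE gE.
Qed.

Lemma polyfun_sum m k (F : 'I_k -> (nat -> R) -> R) :
  (forall j, polyfun m (F j)) -> polyfun m (fun v => \sum_(j < k) F j v).
Proof.
elim: k F => [|k IHk] F pF m' mm'.
  by have [p pE] := polyfunC 0 mm'; exists p => v; rewrite big_ord0 -pE.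
have [p pE] := polyfunD (IHk _ (fun j => pF (widen_ord (leqnSn k) j)))
  (pF ord_max) mm'.
by exists p => v; rewrite big_ord_recr -pE.
Qed.

Lemma definable_eq m f g : polyfun m f -> polyfun m g ->
  definable m (fun v => f v = g v).
Proof.
move=> pf pg; have [p pE] := polyfunB pf pg (leqnn m).
rewrite /definable; have := omin_poly O_omin p; congr (O _).
have E (x : 'rV[R]_m) : f (env x) - g (env x) = mpoly.meval (fun i => x 0 i) p.
  rewrite pE; congr (mpoly.meval _ p).
  by apply/funext => i; rewrite env_ord.
apply/seteqP; split => x /=; rewrite -E; first by move/subr0_eq.
by move->; rewrite subrr.
Qed.

(** The instance [m' = m] of [polyfun] represents [f] by a polynomial in the variables below [m]
    alone. *)
Lemma polyfun_local m f v v' : polyfun m f ->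
  (forall i, (i < m)%N -> v i = v' i) -> f v = f v'.
Proof.
move=> pf vv'; have [p pE] := pf m (leqnn m); rewrite !pE.
congr (mpoly.meval _ p); apply/funext => i; exact: vv'.
Qed.

Lemma polyfun_weaken m m' f : (m <= m')%N -> polyfun m f -> polyfun m' f.
Proof. by move=> mm' pf k /(leq_trans mm')/pf. Qed.

(* f <= g iff g - f is a square. *)
Lemma definable_le m f g : polyfun m f -> polyfun m g ->
  definable m (fun v => f v <= g v).
Proof.
move=> pf pg.
have pt : polyfun m.+1 (fun v => v m) by exact: polyfunX.
have pw h : polyfun m h -> polyfun m.+1 h by apply: polyfun_weaken.
have := definable_exists1 (definable_eq (pw _ pg)
  (polyfunD (pw _ pf) (polyfunM pt pt))).
apply: definable_iff => v.
have E h t : polyfun m h -> h (upd v m t) = h v.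
  move=> ph; apply: (polyfun_local ph) => i im.
  by rewrite /upd ltn_eqF.
split => [[t]|fg].
  by rewrite !E // => ->; rewrite lerDl -expr2 sqr_ge0.
exists (Num.sqrt (g v - f v)); rewrite !E // /upd eqxx -expr2 sqr_sqrtr.
  by rewrite addrC subrK.
by rewrite subr_ge0.
Qed.

Lemma definable_lt m f g : polyfun m f -> polyfun m g ->
  definable m (fun v => f v < g v).
Proof.
move=> pf pg; apply: definable_iff (definable_not (definable_le pg pf)) => v.
by rewrite ltNge; split => /negP.
Qed.

(** Dummy coordinates are put in front one at a time, each by a product with the line on the
    left. *)
Lemma definable_shift m k (A : set 'rV[R]_k) : O A ->
  definable (m + k) (fun v => A (vec k v m)).
Proof.
move=> OA; elim: m => [|m IHm].
  rewrite /definable; move: OA; congr (O _); apply/seteqP.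
  have E (x : 'rV[R]_k) : vec k (env x) 0 = x.
    by apply/rowP => j; rewrite mxE add0n env_ord.
  by split => x; rewrite /= E.
have [_] := omin_prod O_omin IHm; rewrite /definable; congr (O _).
have E (x : 'rV[R]_(m + k).+1) i : env (col' ord0 x) i = env x i.+1.
  case: (ltnP i (m + k)) => im; last by rewrite !env_out.
  rewrite -[i]/(nat_of_ord (Ordinal im)) env_ord mxE.
  by rewrite -env_ord.
suff F (x : 'rV[R]_(m + k).+1) : vec k (env (col' ord0 x)) m = vec k (env x) m.+1.
  by apply/seteqP; split => x; rewrite /= F.
by apply/rowP => j; rewrite !mxE E.
Qed.

(** Substitution of variables, with repetitions and permutations allowed, reduces to a quantifier: a
    fresh block [w] lies in [A] and agrees coordinatewise with the selected variables. *)
Lemma definable_reindex m k (A : set 'rV[R]_k) (s : 'I_k -> nat) : O A ->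
  (forall j, (s j < m)%N) -> definable m (fun v => A (\row_j v (s j))).
Proof.
move=> OA sm.
apply: (@definable_iff _ (fun v => exists w, A w /\ w = \row_j v (s j))).
  by move=> v; split=> [[w [Aw <-//]]|Av]; exists (\row_j v (s j)).
apply: definable_existsv.
  move=> v v' w vv' [Aw wE]; split => //; rewrite wE.
  by apply/rowP => j; rewrite !mxE vv'.
apply: definable_and; first exact: definable_shift.
apply: (@definable_iff _ (fun v => forall j : 'I_k, v (m + j)%N = v (s j))).
  move=> v; split=> [vE|/rowP vE j]; last by have := vE j; rewrite !mxE.
  by apply/rowP => j; rewrite !mxE vE.
apply: definable_forall_fin => j.
by apply: definable_eq; apply: polyfunX; rewrite ?ltn_add2l // ltn_addr.
Qed.

Lemma definable_graph m k (F : 'rV[R]_k -> 'rV[R]_k) a b :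
  definable_fun O F -> (a + k <= m)%N -> (b + k <= m)%N ->
  definable m (fun v => vec k v b = F (vec k v a)).
Proof.
move=> dF akm bkm.
(* The first half of a point of the graph is read from the block at [a], the second half from the
   block at [b]. *)
pose s (j : 'I_(k + k)) :=
  match fintype.split j with inl i => a + i | inr i => b + i end%N.
have sm j : (s j < m)%N.
  rewrite /s; case: (fintype.split j) => i; [apply: leq_trans akm|apply: leq_trans bkm];
    by rewrite ltn_add2l.
apply: definable_iff (definable_reindex dF sm) => v /=.
have -> : rsubmx (\row_j v (s j)) = vec k v b.
  apply/rowP => j; rewrite !mxE /s.
  by rewrite -[rshift k j]/(unsplit (inr j)) unsplitK.
have -> : lsubmx (\row_j v (s j)) = vec k v a.
  apply/rowP => j; rewrite !mxE /s.
  by rewrite -[lshift k j]/(unsplit (inl j)) unsplitK.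
by [].
Qed.

End Definability.

(** * Regular variation of tame monotone functions *)

Section RegularVariation.
Context {R : realType}.
Implicit Types (P : R -> Prop) (x e lam mu : R).

Lemma near0P P : (\forall x \near 0^'+, P x) <->
  exists2 e, 0 < e & forall x, 0 < x < e -> P x.
Proof.
split=> [[e /= e0 eP]|[e e0 eP]].
  exists e => // x /andP[x0 xe]; apply: eP => //=.
  by rewrite sub0r normrN gtr0_norm.
by near=> x; apply: eP; apply/andP; split; near: x;
  [exact: nbhs_right_gt|exact: nbhs_right_lt].
Unshelve. all: by end_near. Qed.

Lemma near0_scale P lam : 0 < lam -> (\forall x \near 0^'+, P x) ->
  \forall x \near 0^'+, P (lam * x).
Proof.
move=> lam0 /near0P[e e0 eP]; apply/near0P; exists (e / lam).
  exact: divr_gt0.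
move=> x /andP[x0 xe]; apply: eP; rewrite mulr_gt0 //=.
by rewrite mulrC -ltr_pdivlMr.
Qed.

Lemma cvg0_scale (F : R -> R) (l lam : R) : 0 < lam ->
  F x @[x --> 0^'+] --> l -> F (lam * x) @[x --> 0^'+] --> l.
Proof.
move=> lam0 /cvgrPdist_lt Fl; apply/cvgrPdist_lt => e e0.
exact: (near0_scale (P := fun x => `|l - F x| < e) lam0 (Fl _ e0)).
Qed.

(** Membership is the conjunction of two bound conditions, and each is settled near [0^'+] by the
    position of its endpoint relative to 0, whether the endpoint is included or not. *)
Lemma near0_interval (I : interval R) :
  (\forall x \near (0 : R)^'+, x \in I) \/ (\forall x \near (0 : R)^'+, x \notin I).
Proof.
case: I => l u.
have Hl : (\forall x \near (0 : R)^'+, (l <= BLeft x)%O) \/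
    (\forall x \near (0 : R)^'+, ~~ (l <= BLeft x)%O).
  case: l => [b c|[]]; last 2 first.
  - by left; apply: nearW.
  - by right; apply: nearW.
  case: (leP c 0) => c0; [left|right]; apply/near0P.
    exists 1 => // x /andP[x0 _].
    by have := le_lt_trans c0 x0; case: b; rewrite bnd_simp => // /ltW.
  exists c => // x /andP[x0 xc].
  by case: b; rewrite bnd_simp -?ltNge -?leNgt // ltW.
have Hu : (\forall x \near (0 : R)^'+, (BRight x <= u)%O) \/
    (\forall x \near (0 : R)^'+, ~~ (BRight x <= u)%O).
  case: u => [b c|[]]; last 2 first.
  - by right; apply: nearW.
  - by left; apply: nearW.
  case: (leP c 0) => c0; [right|left]; apply/near0P.
    exists 1 => // x /andP[x0 _].
    by have := le_lt_trans c0 x0; case: b; rewrite bnd_simp -?ltNge -?leNgt // => /ltW.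
  exists c => // x /andP[x0 xc].
  by case: b; rewrite bnd_simp // ltW.
case: Hl => Hl; last first.
  by right; apply: filterS Hl => x; rewrite itv_boundlr => /negPf ->.
case: Hu => Hu; last first.
  by right; apply: filterS Hu => x; rewrite itv_boundlr andbC => /negPf ->.
by left; apply: filterS2 Hl Hu => x; rewrite itv_boundlr => -> ->.
Qed.

Lemma near0_intervals (s : seq (interval R)) :
  (\forall x \near (0 : R)^'+, exists2 I, I \in s & x \in I) \/
  (\forall x \near (0 : R)^'+, ~ exists2 I, I \in s & x \in I).
Proof.
elim: s => [|I s IHs]; first by right; apply: nearW => x [].
have [xI|xI] := near0_interval I.
  by left; apply: filterS xI => x xI; exists I => //; rewrite mem_head.
case: IHs => [xs|xs]; [left|right].
  by apply: filterS xs => x [J Js xJ]; exists J => //; rewrite inE Js orbT.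
apply: filterS2 xI xs => x xI xs [J]; rewrite inE => /predU1P[->|Js xJ].
  by rewrite (negPf xI).
by apply: xs; exists J.
Qed.

(** Cauchy's functional equation: positivity makes [G] monotone, so squeezing [k * s] between
    consecutive integers bounds [k] times the error by [rho], uniformly in [k]. The Archimedean
    property then kills the error. *)
Lemma additive_linear (G : R -> R) :
  (forall s, 0 <= s -> 0 <= G s) ->
  (forall s t, 0 <= s -> 0 <= t -> G (s + t) = G s + G t) ->
  forall s, 0 <= s -> G s = s * G 1.
Proof.
move=> G0 GD s s0; set rho := G 1.
have rho0 : 0 <= rho by exact: G0.
have Gz : G 0 = 0.
  by apply/(addrI (G 0)); rewrite addr0 -GD // addr0.
have Gn t k : 0 <= t -> G (k%:R * t) = k%:R * G t.
  move=> t0; elim: k => [|k IHk]; first by rewrite !mul0r.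
  by rewrite -natr1 !mulrDl !mul1r GD ?IHk // mulr_ge0.
have Gle t u : 0 <= t -> t <= u -> G t <= G u.
  move=> t0 tu; have -> : u = t + (u - t) by rewrite addrC subrK.
  by rewrite GD ?subr_ge0 // lerDl G0 // subr_ge0.
have close k : `|k%:R * (G s - s * rho)| <= rho.
  have ks0 : 0 <= k%:R * s by rewrite mulr_ge0.
  have /andP[m1 m2] := truncn_itv ks0; set m := Num.trunc _ in m1 m2.
  have L := Gle _ _ (ler0n R m) m1.
  have U := Gle _ _ ks0 (ltW m2).
  have E j : G j%:R = j%:R * rho by rewrite -[j%:R in LHS]mulr1 Gn.
  rewrite !E Gn // in L U.
  have L' : m%:R * rho <= k%:R * s * rho by rewrite ler_wpM2r.
  have U' : k%:R * s * rho <= m.+1%:R * rho by rewrite ler_wpM2r // ltW.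
  rewrite -natr1 mulrDl mul1r in U U'.
  rewrite mulrBr mulrA ler_norml; apply/andP; split; lra.
apply/eqP; rewrite -subr_eq0 -normr_eq0; apply/eqP/le_anti.
rewrite normr_ge0 andbT leNgt; apply/negP => D0.
set D := `|_| in D0.
(* This integer exceeds [rho / D], which contradicts the uniform bound. *)
have := close (Num.trunc (rho / D)).+1; rewrite normrM ger0_norm // -/D.
rewrite leNgt => /negP; apply; rewrite -ltr_pdivrMr //.
by have /andP[] := truncn_itv (divr_ge0 rho0 (ltW D0)).
Qed.

(** * Existence and power form of the limit ratios *)

Section Index.
Variables (f : R -> R) (K : R).
Hypothesis f_gt0 : forall x, 0 < x -> 0 < f x.
Hypothesis f_nd : {homo f : x y / x <= y}.
Hypothesis K_gt0 : 0 < K.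
Hypothesis f_lin : \forall x \near 0^'+, K * x <= f x.
Hypothesis f_tame : forall lam c, 0 < lam <= 1 -> 0 < c ->
  (\forall x \near 0^'+, f (lam * x) < c * f x) \/
  (\forall x \near 0^'+, ~ (f (lam * x) < c * f x)).

Let ratio lam x := f (lam * x) / f x.

Lemma ratio_le1 lam x : 0 < lam <= 1 -> 0 < x -> ratio lam x <= 1.
Proof.
move=> /andP[lam0 lam1] x0; rewrite ler_pdivrMr ?f_gt0 // mul1r f_nd //.
by rewrite ler_piMl // ltW.
Qed.

Lemma ratio_gt0 lam x : 0 < lam -> 0 < x -> 0 < ratio lam x.
Proof. by move=> lam0 x0; rewrite divr_gt0 // f_gt0 // mulr_gt0. Qed.

(** The limit is the supremum of the eventual lower bounds of the ratio. By tameness, a threshold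
    slightly above it is either an eventual strict upper bound, as wanted, or again an eventual
    lower bound, which is absurd. *)
Lemma ratio_cvg lam : 0 < lam <= 1 ->
  exists g : R, ratio lam x @[x --> 0^'+] --> g.
Proof.
move=> lam01; have /andP[lam0 _] := lam01.
pose S := [set c : R | \forall x \near (0 : R)^'+, c <= ratio lam x].
have S0 : S 0.
  by apply/near0P; exists 1 => // x /andP[x0 _]; rewrite ltW // ratio_gt0.
have S1 : ubound S 1.
  move=> c Sc; near (0 : R)^'+ => x.
  apply: (@le_trans _ _ (ratio lam x)); first by near: x.
  by apply: ratio_le1 => //; near: x; exact: nbhs_right_gt.
have hS : has_sup S by split; [exists 0|exists 1].
exists (sup S); apply/cvgrPdist_lt => e e0.
have [c Sc cS] := sup_adherent e0 hS.
have supS0 : 0 <= sup S by exact: (sup_upper_bound hS).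
have U : \forall x \near (0 : R)^'+, ratio lam x < sup S + e / 2.
  have c0 : 0 < sup S + e / 2 by rewrite ltr_wpDl // divr_gt0.
  have [H|H] := f_tame lam01 c0.
  - apply: filterS2 H (nbhs_right_gt (0 : R)) => x H x0.
    by rewrite ltr_pdivrMr // f_gt0.
  - have : S (sup S + e / 2).
      apply: filterS2 H (nbhs_right_gt (0 : R)) => x /negP H x0.
      by rewrite -leNgt in H; rewrite ler_pdivlMr // f_gt0.
    move/(sup_upper_bound hS); lra.
apply: filterS2 Sc U => x cx xU; rewrite ltr_norml; apply/andP; split; lra.
Unshelve. all: by end_near. Qed.

(** If [g < mu < lam], iterating the ratio bound makes [f] decay like [mu ^+ k] along
    [lam ^+ k * x0], whereas the linear lower bound only allows decay like [lam ^+ k]. *)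
Lemma ratio_lim_ge lam (g : R) : 0 < lam <= 1 ->
  ratio lam x @[x --> 0^'+] --> g -> lam <= g.
Proof.
move=> lam01; have /andP[lam0 lam1] := lam01 => ratio_g.
rewrite leNgt; apply/negP => glam.
have g0 : 0 <= g.
  apply: (cvgr_to_ge ratio_g); near=> x.
  by rewrite ltW // ratio_gt0 //; near: x; exact: nbhs_right_gt.
pose mu := (g + lam) / 2.
have gmu : g < mu by rewrite /mu; lra.
have mulam : mu < lam by rewrite /mu; lra.
have mu0 : 0 < mu by exact: le_lt_trans gmu.
have near_mu : \forall x \near (0 : R)^'+, ratio lam x < mu.
  exact: (cvgr_lt _ ratio_g).
have [e1 e10 lt_mu] := (near0P _).1 near_mu.
have [e2 e20 fK] := (near0P _).1 f_lin.
(* Both eventual bounds hold at [x0] and at all points [lam ^+ k * x0], which never exceed [x0]. *)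
pose x0 := Num.min e1 e2 / 2.
have m0 : 0 < Num.min e1 e2 by rewrite lt_min e10.
have x00 : 0 < x0 by rewrite divr_gt0.
have x0m : x0 < Num.min e1 e2 by rewrite /x0; lra.
have [x0e1 x0e2] : x0 < e1 /\ x0 < e2.
  by move: x0m; rewrite lt_min => /andP.
have iter k : 0 < lam ^+ k * x0 <= x0 /\ f (lam ^+ k * x0) <= mu ^+ k * f x0.
  elim: k => [|k [/andP[k0 kx] IHk]]; first by rewrite !expr0 !mul1r x00 /=.
  have lk : lam ^+ k.+1 * x0 = lam * (lam ^+ k * x0) by rewrite exprS mulrA.
  split; rewrite lk.
    by rewrite mulr_gt0 //= (le_trans _ kx) // ler_piMl // ltW.
  have := lt_mu (lam ^+ k * x0).
  rewrite k0 (le_lt_trans kx) // => /(_ isT).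
  rewrite /ratio ltr_pdivrMr ?f_gt0 // => /ltW /le_trans; apply.
  by rewrite exprS -mulrA ler_pM2l.
have ratio1 : `|mu / lam| < 1.
  have ml0 : 0 < mu / lam by exact: divr_gt0.
  by rewrite gtr0_norm // ltr_pdivrMr // mul1r.
(* The two bounds on [f (lam ^+ k * x0)] would force [(mu / lam) ^+ k] to stay above this constant,
   although it tends to 0. *)
have q0 : 0 < K * x0 / f x0 by rewrite divr_gt0 ?mulr_gt0 // f_gt0.
have [k _ kP] := cvgr_lt _ (@cvg_expr _ _ ratio1) _ q0.
have := kP k (leqnn k); rewrite /= ltNge => /negP; apply.
have [/andP[k0 kx] fk] := iter k.
rewrite expr_div_n ler_pdivrMr ?f_gt0 // mulrAC ler_pdivlMr ?exprn_gt0 //.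
apply: le_trans fk; rewrite mulrAC -mulrA; apply: fK.
by rewrite k0 (le_lt_trans kx).
Unshelve. all: by end_near. Qed.

Lemma regular_variation_index : exists rho, 0 <= rho <= 1 /\
  forall lam, 0 < lam -> ratio lam x @[x --> 0^'+] --> lam `^ rho.
Proof.
pose g lam : R := lim (ratio lam x @[x --> 0^'+]).
have gP lam : 0 < lam <= 1 -> ratio lam x @[x --> 0^'+] --> g lam.
  move=> lam01; have [l rl] := ratio_cvg lam01.
  by rewrite /g (cvg_lim _ rl).
have g_ge lam : 0 < lam <= 1 -> lam <= g lam.
  by move=> lam01; apply: ratio_lim_ge (gP _ lam01).
have g_le1 lam : 0 < lam <= 1 -> g lam <= 1.
  move=> lam01; apply: (cvgr_to_le (gP _ lam01)); near=> x.
  by apply: ratio_le1 => //; near: x; exact: nbhs_right_gt.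
have gM lam mu : 0 < lam <= 1 -> 0 < mu <= 1 -> g (lam * mu) = g lam * g mu.
  move=> lam01 mu01; have /andP[lam0 lam1] := lam01.
  have /andP[mu0 mu1] := mu01.
  apply: (cvg_lim (@Rhausdorff R)).
  (* For [x > 0], [ratio (lam * mu) x] factors as [ratio lam (mu * x) * ratio mu x]. *)
  apply: cvg_trans (cvgM (cvg0_scale mu0 (gP _ lam01)) (gP _ mu01)).
  apply: near_eq_cvg; near=> x.
  have x0 : 0 < x by near: x; exact: nbhs_right_gt.
  rewrite /ratio /= [_ / _ * (_ / _)]mulrA divfK ?mulrA //.
  by rewrite gt_eqF // f_gt0 // mulr_gt0.
pose G s := - ln (g (expR (- s))).
have e01 (s : R) : 0 <= s -> 0 < expR (- s) <= 1.
  by move=> s0; rewrite expR_gt0 -expR0 ler_expR oppr_le0.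
have g_gt0 lam : 0 < lam <= 1 -> 0 < g lam.
  by move=> lam01; have /andP[lam0 _] := lam01; rewrite (lt_le_trans lam0) ?g_ge.
have G0 (s : R) : 0 <= s -> 0 <= G s.
  by move=> /e01 es; rewrite oppr_ge0 ln_le0 // g_le1.
have GD (s t : R) : 0 <= s -> 0 <= t -> G (s + t) = G s + G t.
  move=> /e01 es /e01 et.
  by rewrite /G opprD expRD gM // lnM ?posrE ?g_gt0 // opprD.
have Glin := additive_linear G0 GD.
pose rho := G 1.
have gE lam : 0 < lam <= 1 -> g lam = lam `^ rho.
  move=> lam01; have /andP[lam0 lam1] := lam01.
  have s0 : 0 <= - ln lam by rewrite oppr_ge0 ln_le0.
  have := Glin _ s0; rewrite {1}/G opprK lnK ?posrE // => /eqP.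
  rewrite -/rho mulNr eqr_opp => /eqP E.
  by rewrite /powR gt_eqF // mulrC -E lnK // posrE g_gt0.
exists rho; split.
  (* The upper bound [rho <= 1] is [lam <= g lam] at [lam = expR (- 1)]. *)
  rewrite /rho G0 //= /G lerNl.
  have e1 := e01 1 ler01; have := g_ge _ e1.
  by rewrite -ler_ln ?posrE ?expR_gt0 ?g_gt0 // expRK.
move=> lam lam0; case: (leP lam 1) => lam1.
  by rewrite -gE ?lam0 //; apply: gP; rewrite lam0.
(* For [lam > 1], [ratio lam x] is the inverse of [ratio lam^-1 (lam * x)], which reduces to the
   case already treated. *)
have mu01 : 0 < lam^-1 <= 1 by rewrite invr_gt0 lam0 invf_le1 // ltW.
have gn0 : g lam^-1 != 0 by rewrite gt_eqF // g_gt0.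
have -> : lam `^ rho = (g lam^-1)^-1.
  rewrite gE // /powR !gt_eqF ?invr_gt0 // lnV ?posrE // mulrN expRN.
  by rewrite invrK.
apply: cvg_trans (cvg0_scale lam0 (cvgV gn0 (gP _ mu01))).
apply: near_eq_cvg; near=> x.
by rewrite /ratio /= mulKf ?gt_eqF // invf_div.
Unshelve. all: by end_near. Qed.

End Index.
End RegularVariation.

(** * The function Phi *)

Section ErrorBound.
Context {R : realType} {E : normedModType R} {n : nat}.
Variable L : 'I_n -> E -> E.
(** Finite dimension enters this section only in this form; [euclidean_ball_compact] derives it from
    an orthonormal basis. *)
Hypothesis ball_compact : forall r : R, compact [set y : E | `|y| <= r].
Hypothesis L_continuous : forall i, continuous (L i).
Hypothesis L_fix : common_fix L !=set0.
Hypothesis L_qne : forall i, quasi_nonexpansive (L i).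
Implicit Types (x y z p q : E) (a b r : R).

Let C := common_fix L.

(** The conjunct [0 <= a] reflects the initial value 0 of the maximum and carries all the content
    when the family is empty. *)
Lemma residual_leP x a :
  residual L x <= a <-> 0 <= a /\ forall i, `|x - L i x| <= a.
Proof.
split=> [/bigmax_leP[a0 xa]|[a0 xa]]; first by split => // i; exact: xa.
by apply/bigmax_leP; split => // i _; exact: xa.
Qed.

Lemma residual_ge0 x : 0 <= residual L x.
Proof. by have [] := (residual_leP x _).1 (lexx _). Qed.

Lemma residual_le0 x : residual L x <= 0 <-> C x.
Proof.
rewrite residual_leP; split=> [[_ x0] i _|Cx].
  by have := x0 i; rewrite normr_le0 subr_eq0 => /eqP.
by split=> // i; rewrite (Cx i) // subrr normr0.
Qed.

Lemma residual_continuous : continuous (residual L).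
Proof.
rewrite /residual; elim: (index_enum _) => [|i s IHs].
  under eq_fun do rewrite big_nil.
  exact: cst_continuous.
under eq_fun do rewrite big_cons.
move=> x; apply: (@continuous_max _ _ (fun x => `|x - L i x|)) => //.
  apply: (@continuous_comp _ _ _ (fun x => x - L i x) Num.norm).
    by apply: cvgB => //; exact: L_continuous.
  exact: norm_continuous.
exact: IHs.
Qed.

Lemma common_fix_closed : closed C.
Proof.
have -> : C = residual L @^-1` [set t | t <= 0].
  by apply/seteqP; split => x /residual_le0.
by apply: preimage_closed => [x _|]; [exact: residual_continuous|exact: closed_le].
Qed.

Lemma dist_attained x : exists p, [/\ C p, dist x C = `|x - p| &
  forall q, C q -> `|x - p| <= `|x - q|].
Proof.
have [c Cc] := L_fix.
(* The ball contains [c], and every point outside it is farther from [x] than [c], so a minimum over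
   [K] is a minimum over [C]. *)
pose K := [set y : E | `|y| <= `|x| + `|x - c|] `&` C.
have K_compact : compact K.
  exact/compact_closedI/common_fix_closed.
have Kc : K c.
  split=> //=; rewrite -[X in `|X|](subKr x); apply: le_trans (ler_normB _ _) _.
  by rewrite distrC.
have dcont : {within K, continuous (fun y => `|x - y|)}.
  apply: continuous_subspaceT => y.
  apply: (@continuous_comp _ _ _ (fun y => x - y) Num.norm).
    by apply: cvgB => //; exact: cvg_cst.
  exact: norm_continuous.
have [p /set_mem[_ Cp] pmin] := compact_EVT_min (ex_intro _ c Kc) K_compact dcont.
have pC q : C q -> `|x - p| <= `|x - q|.
  move=> Cq; case: (leP `|q| (`|x| + `|x - c|)) => qK.
    by apply: pmin; apply/mem_set.
  apply: (le_trans (pmin _ (mem_set Kc))); rewrite -(lerD2l `|x|).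
  apply: (le_trans (ltW qK)).
  by rewrite -[X in `|X|](subKr x); exact: ler_normB.
exists p; split=> //; apply/le_anti/andP; split.
  by apply: ge_inf; [exists 0 => _ [q _ <-]|exists p].
apply: lb_le_inf; first by exists `|x - p|, p.
by move=> _ [q Cq <-]; exact: pC.
Qed.

Lemma dist_le x q : C q -> dist x C <= `|x - q|.
Proof. by move=> Cq; have [p [_ -> pC]] := dist_attained x; exact: pC. Qed.

Lemma dist_ge0 x : 0 <= dist x C.
Proof. by have [p [_ -> _]] := dist_attained x. Qed.

Lemma dist_eq0 x : C x -> dist x C = 0.
Proof.
move=> Cx; apply/le_anti; rewrite dist_ge0 andbT.
by apply: le_trans (dist_le x Cx) _; rewrite subrr normr0.
Qed.

Lemma dist_lip x y : dist x C <= dist y C + `|x - y|.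
Proof.
have [p [Cp -> _]] := dist_attained y.
apply: le_trans (dist_le x Cp) _; rewrite [leRHS]addrC.
have -> : x - p = x - y + (y - p) by rewrite addrA subrK.
exact: ler_normD.
Qed.

Lemma dist_continuous : continuous (fun x => dist x C).
Proof.
move=> x; apply/cvgrPdist_lt => e e0.
have xe : \forall y \near x, `|x - y| < e.
  by have := nbhsx_ballx x e e0; rewrite -ball_normE.
apply: filterS xe => y xy; apply: le_lt_trans xy.
have := dist_lip x y; have := dist_lip y x; rewrite (distrC y x) => yx' xy'.
rewrite ler_norml; apply/andP; split; lra.
Qed.

Lemma Omega_compact a r : compact (Omega L a r).
Proof.
have -> : Omega L a r =
    [set y : E | `|y| <= r] `&` (residual L @^-1` [set t | t <= a]).
  by apply/seteqP; split => y [].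
apply: compact_closedI => //; apply: preimage_closed => [x _|].
  exact: residual_continuous.
exact: closed_le.
Qed.

(** Compactness of [Omega] provides a maximizer, which excludes the default value of [set_max]. *)
Lemma Phi_max a r : Omega L a r !=set0 -> exists y, [/\ Omega L a r y,
  Phi L a r = dist y C & forall z, Omega L a r z -> dist z C <= Phi L a r].
Proof.
move=> On0; rewrite /Phi asboolT //.
have [y /set_mem Oy ymax] := compact_EVT_max On0 (@Omega_compact a r)
  (continuous_subspaceT dist_continuous).
rewrite /set_max; case: xgetP => [d _ [[z Oz zd] dub]|noMax].
  by exists z; split=> // u Ou; apply: dub; exists u.
case: (noMax (dist y C)); split; first by exists y.
by move=> _ [z Oz <-]; apply: ymax; apply/mem_set.
Qed.

Lemma Phi_ge0 a r : 0 <= Phi L a r.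
Proof.
have [On0|On0] := pselect (Omega L a r !=set0).
  by have [y [_ -> _]] := Phi_max On0; exact: dist_ge0.
by rewrite /Phi asboolF.
Qed.

Lemma Phi_ub a r x : Omega L a r x -> dist x C <= Phi L a r.
Proof. by move=> Ox; have [y [_ _]] := Phi_max (ex_intro _ x Ox); apply. Qed.

(** The whole line is covered, negative arguments included, because [Phi] is 0 on an empty [Omega]
    and nonnegative elsewhere. *)
Lemma Phi_nd r : {homo (Phi L ^~ r) : a b / a <= b}.
Proof.
move=> a b ab; have [On0|On0] := pselect (Omega L a r !=set0); last first.
  by rewrite {1}/Phi asboolF // Phi_ge0.
have [y [[ya yr] -> _]] := Phi_max On0.
by apply: Phi_ub; split => //; exact: le_trans ab.
Qed.

Lemma Phi_eq0 r : Phi L 0 r = 0.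
Proof.
have [On0|On0] := pselect (Omega L 0 r !=set0); last by rewrite /Phi asboolF.
have [y [[/residual_le0 Cy _] -> _]] := Phi_max On0.
exact: dist_eq0.
Qed.

(** On the compact set of points of the ball at distance at least [e] from [C], the residual has a
    positive minimum; for [t] below it, [Omega] avoids that set. *)
Lemma Phi_cvg0 r : Phi L t r @[t --> 0^'+] --> (0 : R).
Proof.
apply/cvgrPdist_lt => e e0.
pose K := [set y : E | `|y| <= r] `&` ((fun y => dist y C) @^-1` [set t | e <= t]).
have K_compact : compact K.
  apply: compact_closedI => //; apply: preimage_closed => [x _|].
    exact: dist_continuous.
  exact: closed_ge.
have small m : 0 < m -> (forall y, K y -> m <= residual L y) ->
    \forall t \near 0^'+, `|0 - Phi L t r| < e.
  move=> m0 Km; near=> t.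
  rewrite sub0r normrN ger0_norm ?Phi_ge0 //.
  have [On0|On0] := pselect (Omega L t r !=set0); last by rewrite /Phi asboolF.
  have [y [[yt yr] -> _]] := Phi_max On0.
  rewrite ltNge; apply/negP => ey.
  have := le_trans (Km y (conj yr ey)) yt; apply/negP; rewrite -ltNge.
  by near: t; exact: nbhs_right_lt.
(* If no point of the ball is that far from [C], any positive threshold works, for instance 1. *)
have [K0|K0] := pselect (K !=set0); last first.
  by apply: (small 1) => // y Ky; case: K0; exists y.
have [y /set_mem[yr ye] ymin] := compact_EVT_min K0 K_compact
  (continuous_subspaceT residual_continuous).
apply: (small (residual L y)) => [|z Kz]; last by apply: ymin; apply/mem_set.
rewrite ltNge; apply/negP => /residual_le0 /dist_eq0 y0.
by move: ye; rewrite /= y0 leNgt e0.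
Unshelve. all: by end_near. Qed.

(** Going from [x] to [L i x] through a nearest point [p] of [C] costs at most [|x - p|] twice, the
    second time by quasi-nonexpansiveness. *)
Lemma residual_le_dist x : residual L x <= 2 * dist x C.
Proof.
apply/residual_leP; split; first by rewrite mulr_ge0 // dist_ge0.
move=> i; have [p [Cp -> _]] := dist_attained x.
have -> : x - L i x = (x - p) - (L i x - p) by rewrite opprB addrA subrK.
apply: le_trans (ler_normB _ _) _.
by rewrite mulr_natl mulr2n lerD2l; apply: L_qne; exact: Cp.
Qed.

(** By the intermediate value theorem, some point of the segment from [c] to [x0] has residual
    exactly [a]. Convexity keeps it in the ball, and its distance to [C] is at least half its
    residual. *)
Lemma Phi_linear_lb x0 c r : ~ C x0 -> C c -> `|x0| <= r -> `|c| <= r ->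
  forall a, 0 <= a <= residual L x0 -> a / 2 <= Phi L a r.
Proof.
move=> nCx0 Cc x0r cr a /andP[a0 ax0].
pose y t : E := c + t *: (x0 - c).
have y_cont : continuous y.
  move=> t; apply: cvgD; first exact: cvg_cst.
  exact: cvgZr_tmp.
have g_cont : {within `[0, 1], continuous (residual L \o y)}.
  apply: continuous_subspaceT => t.
  by apply: continuous_comp; [exact: y_cont|exact: residual_continuous].
have gc : residual L (y 0) = 0.
  apply/le_anti; rewrite residual_ge0 andbT; apply/residual_le0.
  by rewrite /y scale0r addr0.
have g1 : y 1 = x0 by rewrite /y scale1r addrC subrK.
have [t] : exists2 t, t \in `[0, 1] & (residual L \o y) t = a.
  apply: IVT => //=; rewrite gc g1 min_l ?max_r ?residual_ge0 //.
  by rewrite a0.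
rewrite in_itv /= => /andP[t0 t1] ta.
have yr : `|y t| <= r.
  have -> : y t = (1 - t) *: c + t *: x0.
    by rewrite /y scalerBr scalerBl scale1r addrA addrAC.
  apply: le_trans (ler_normD _ _) _; rewrite !normrZ.
  rewrite (ger0_norm t0) ger0_norm ?subr_ge0 //.
  have -> : r = (1 - t) * r + t * r by rewrite -mulrDl subrK mul1r.
  by apply: lerD; apply: ler_wpM2l => //; rewrite subr_ge0.
apply: (@le_trans _ _ (dist (y t) C)).
  by rewrite ler_pdivrMr // mulrC -ta residual_le_dist.
by apply: Phi_ub; split => //; rewrite -ta.
Qed.

End ErrorBound.

(** * Definability of Phi *)

Section Coordinates.
Context {R : realType} {E : normedModType R} {ip : {dot E for idfun}}.
Hypothesis ip_norm : euclidean_norm ip.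
Context {d : nat} {e : 'I_d -> E}.
Hypothesis e_basis : orthonormal_basis ip e.
Implicit Types (u w : 'rV[R]_d) (x y : E) (a b m : nat).

Definition of_coord (e : 'I_d -> E) u : E := \sum_(i < d) u 0 i *: e i.

(** Squares keep distances polynomial in the coordinates, so that formulas need no square root. *)
Definition sqdist u w : R := \sum_(j < d) (u 0 j - w 0 j) * (u 0 j - w 0 j).

Lemma ip_of_coordl u x : ip (of_coord e u) x = \sum_(i < d) u 0 i * ip (e i) x.
Proof.
rewrite /of_coord.
rewrite (big_morph (fun y => ip y x) (linearDl ip x) (linear0l ip x)).
by apply: eq_bigr => i _; rewrite linearZl_LR.
Qed.

Lemma ip_of_coordr u x : ip x (of_coord e u) = \sum_(i < d) u 0 i * ip x (e i).
Proof.
rewrite /of_coord.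
rewrite (big_morph (ip x) (linearDr ip x) (linear0r ip x)).
by apply: eq_bigr => i _; rewrite linearZr_LR.
Qed.

Lemma ip_of_coord u j : ip (of_coord e u) (e j) = u 0 j.
Proof.
rewrite ip_of_coordl (bigD1 j) //= big1 => [|i ij].
  by rewrite addr0 e_basis.1 eqxx mulr1.
by rewrite e_basis.1 (negPf ij) mulr0.
Qed.

Lemma of_coord_inj : injective (of_coord e).
Proof. by move=> u w uw; apply/rowP => j; rewrite -!ip_of_coord uw. Qed.

Lemma of_coordK x : of_coord e (\row_j ip x (e j)) = x.
Proof.
have [c ->] := e_basis.2 x.
have -> : \sum_(i < d) c i *: e i = of_coord e (\row_i c i).
  by apply: eq_bigr => i _; rewrite mxE.
by congr (of_coord e _); apply/rowP => j; rewrite !mxE ip_of_coord mxE.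
Qed.

Lemma of_coordB u w : of_coord e u - of_coord e w = of_coord e (u - w).
Proof.
rewrite /of_coord -sumrB; apply: eq_bigr => i _.
by rewrite !mxE scalerBl.
Qed.

Lemma sqdistE u w : sqdist u w = `|of_coord e u - of_coord e w| ^+ 2.
Proof.
have ip_ge0 x : 0 <= ip x x.
  have [->|/neq0_dnorm_gt0/ltW //] := eqVneq x 0.
  by rewrite linear0l.
rewrite of_coordB ip_norm sqr_sqrtr // ip_of_coordr.
by apply: eq_bigr => j _; rewrite ip_of_coord !mxE.
Qed.

Lemma sqdist_le u w (t : R) : 0 <= t ->
  (sqdist u w <= t * t) = (`|of_coord e u - of_coord e w| <= t).
Proof. by move=> t0; rewrite sqdistE -expr2 ler_sqr ?nnegrE. Qed.

Lemma of_coord_continuous : continuous (of_coord e).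
Proof.
apply: continuous_big => [|i _ u]; first exact: add_continuous.
exact: cvgZr_tmp (@coord_continuous R 1 d 0 i u).
Qed.

(** The ball is a closed subset of the image of the cube of side [2 * r] under the continuous map
    [of_coord e]. *)
Lemma euclidean_ball_compact (r : R) : compact [set y : E | `|y| <= r].
Proof.
pose K := of_coord e @` [set u : 'rV[R]_d | forall i, `[- r, r]%classic (u ord0 i)].
have K_compact : compact K.
  apply: continuous_compact.
    by apply: continuous_subspaceT; exact: of_coord_continuous.
  apply: (rV_compact (A := fun=> `[- r, r]%classic)) => _.
  exact: segment_compact.
apply: (subclosed_compact _ K_compact) => [|y /= yr].
  apply: (@preimage_closed _ _ (fun y : E => `|y|) [set t | t <= r]).
    by move=> x _; exact: norm_continuous.
  exact: closed_le.
have r0 : 0 <= r by exact: le_trans yr.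
exists (\row_j ip y (e j)); last exact: of_coordK.
move=> i; rewrite /= in_itv /= -ler_norml.
(* The square of one coordinate is a term of the sum of squares that equals the squared norm. *)
apply: le_trans yr; rewrite -ler_sqr ?nnegrE // real_normK ?num_real //.
have := sqdistE (\row_j ip y (e j)) 0; rewrite of_coordK.
have -> : of_coord e 0 = 0.
  by rewrite /of_coord big1 // => j _; rewrite mxE scale0r.
rewrite subr0 => <-; rewrite /sqdist (bigD1 i) //= !mxE subr0 -expr2 lerDl.
by apply: sumr_ge0 => j _; rewrite -expr2 sqr_ge0.
Qed.

Lemma polyfun_sqdist m a b : (a + d <= m)%N -> (b + d <= m)%N ->
  polyfun m (fun v : nat -> R => sqdist (vec d v a) (vec d v b)).
Proof.
move=> am bm; rewrite /sqdist.
by apply: polyfun_sum => j; apply: polyfunM; apply: polyfunB; exact: polyfun_vec.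
Qed.

End Coordinates.

(** * Comparison of two values of [Phi] by a first-order formula *)

Section DefinablePhi.
Context {R : realType} {E : normedModType R} {ip : {dot E for idfun}}.
Hypothesis ip_norm : euclidean_norm ip.
Context {d : nat} {e : 'I_d -> E}.
Hypothesis e_basis : orthonormal_basis ip e.
Context {n : nat} {L : 'I_n -> E -> E}.
Hypothesis L_continuous : forall i, continuous (L i).
Hypothesis L_fix : common_fix L !=set0.
Context {O : forall m, set (set 'rV[R]_m)}.
Hypothesis O_omin : o_minimal O.
Hypothesis L_definable : forall i, definable_operator O ip e (L i).
Implicit Types (u w y z p q : 'rV[R]_d) (a b m : nat) (lam c t : R).

Let F i u := \row_(j < d) ip (L i (of_coord e u)) (e j).

Let of_coordF i u : of_coord e (F i u) = L i (of_coord e u).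
Proof. exact: of_coordK. Qed.

Let fixed u := forall i, u = F i u.

Let fixedE u : fixed u <-> common_fix L (of_coord e u).
Proof.
split=> [fu i _|fu i]; first by rewrite /Fix /= -of_coordF -fu.
by apply: (of_coord_inj e_basis); rewrite of_coordF (fu i).
Qed.

Let fixed_definable m a : (a + d <= m)%N ->
  definable O m (fun v => fixed (vec d v a)).
Proof.
move=> am; apply: (definable_forall_fin O_omin) => i.
exact: (definable_graph O_omin (L_definable i)).
Qed.

Variable r : R.
Hypothesis r_ge0 : 0 <= r.

(** Coordinate form of [Omega]. Since [F i] is known to be definable only through its graph, its
    value is named by a quantified [w] before the polynomial inequality is stated. *)
Let omega t u := (forall i, exists w, w = F i u /\ sqdist u w <= t * t) /\
  sqdist u 0 <= r * r.

Let omegaE t u : 0 <= t -> omega t u <-> Omega L t r (of_coord e u).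
Proof.
have e0 : of_coord e 0 = 0.
  by rewrite /of_coord big1 // => j _; rewrite mxE scale0r.
move=> t0; rewrite /omega /Omega /= residual_leP.
rewrite (sqdist_le ip_norm e_basis) // e0 subr0.
split=> [[ut ur]|[[_ ut] ur]]; split=> //.
  split=> // i; have [w [-> ]] := ut i.
  by rewrite (sqdist_le ip_norm e_basis) // of_coordF.
by move=> i; exists (F i u); rewrite (sqdist_le ip_norm e_basis) // of_coordF.
Qed.

(** Variable 0 always carries [t]; the factor [lam] serves both radii of the comparison, with [t]
    itself written [1 * t]. *)
Let omega_definable m a lam : (0 < m)%N -> (a + d <= m)%N ->
  definable O m (fun v => omega (lam * v 0%N) (vec d v a)).
Proof.
move=> m0 am; apply: (definable_and O_omin).
  apply: (definable_forall_fin O_omin) => i.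
  apply: (definable_existsv O_omin) => [v v' w vv'|].
    by rewrite (vec_eq am vv') (vv' 0%N m0).
  have amd : (a + d <= m + d)%N by rewrite leq_add2r (leq_trans _ am) ?leq_addr.
  apply: (definable_and O_omin).
    exact: (definable_graph O_omin (L_definable i)).
  apply: (definable_le O_omin); first exact: polyfun_sqdist.
  by apply: polyfunM; apply: polyfunM;
    (exact: polyfunC || apply: polyfunX; exact: ltn_addr).
apply: (definable_le O_omin); last exact: polyfunC.
rewrite /sqdist; apply: polyfun_sum => j.
have p0 : polyfun m (fun v : nat -> R => vec d v a 0 j - (0 : 'rV[R]_d) 0 j).
  by apply: polyfunB; [exact: polyfun_vec|exact: polyfunC].
exact: polyfunM.
Qed.

(* First-order form of Phi (lam * t) < c * Phi t. *)
Let Phi_lt lam c t := exists y, omega (1 * t) y /\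
  forall z, omega (lam * t) z -> exists p, fixed p /\
    forall q, fixed q -> sqdist z p < c * c * sqdist y q.

(** After [t] in variable 0, the blocks [y], [z], [p], [q] start at [1], [1 + d], [1 + d + d] and
    [1 + d + d + d]; the arithmetic goals check that each block is in scope. *)
Let Phi_lt_definable lam c : definable O 1 (fun v => Phi_lt lam c (v 0%N)).
Proof.
apply: (definable_existsv O_omin) => [v v' y vv'|]; first by rewrite (vv' 0%N).
apply: (definable_and O_omin); first exact: omega_definable.
apply: (definable_forallv O_omin) => [v v' z vv'|].
  by rewrite (vec_eq _ vv') // (vv' 0%N).
apply: (definable_imply O_omin).
  by apply: omega_definable.
apply: (definable_existsv O_omin) => [v v' p vv'|].
  have V a : (a + d <= 1 + d + d)%N -> vec d v a = vec d v' a.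
    by move=> ad; exact: vec_eq vv'.
  by rewrite !V // ?leq_add2r ?leq_addr.
apply: (definable_and O_omin); first exact: fixed_definable.
apply: (definable_forallv O_omin) => [v v' q vv'|].
  have V a : (a + d <= 1 + d + d + d)%N -> vec d v a = vec d v' a.
    by move=> ad; exact: vec_eq vv'.
  by rewrite !V //; lia.
apply: (definable_imply O_omin); first exact: fixed_definable.
apply: (definable_lt O_omin); first apply: polyfun_sqdist;
  last (apply: polyfunM; [exact: polyfunC|apply: polyfun_sqdist]); by lia.
Qed.

Let ball_compact := euclidean_ball_compact ip_norm e_basis.

(** All the maxima and distances involved are attained, so a strict inequality between them unfolds
    into quantifiers: [y] is a maximizer at [t], and [p] is a point of [C] nearest to [z].
    Nonemptiness supplies the maximizer to which the universal quantifier over [z] is applied. *)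
Let Phi_ltE lam c t : 0 < lam -> 0 < c -> 0 < t ->
  Omega L (lam * t) r !=set0 ->
  Phi_lt lam c t <-> Phi L (lam * t) r < c * Phi L t r.
Proof.
move=> lam0 c0 t0 On0.
have lt0 : 0 <= lam * t by rewrite mulr_ge0 // ltW.
have sq_lt u w u' w' : (sqdist u w < c * c * sqdist u' w') =
    (`|of_coord e u - of_coord e w| < c * `|of_coord e u' - of_coord e w'|).
  rewrite !(sqdistE ip_norm e_basis) -expr2 -exprMn ltr_pXn2r ?nnegrE //.
  by rewrite mulr_ge0 // ltW.
have surj x : exists u, of_coord e u = x.
  by exists (\row_j ip x (e j)); exact: of_coordK.
split.
  move=> [y []]; rewrite mul1r => /(omegaE _ (ltW t0)) Oy yP.
  have [x [Ox -> _]] := Phi_max ball_compact L_continuous L_fix On0.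
  have [z zx] := surj x.
  have /yP[p [/fixedE fp pP]] : omega (lam * t) z by apply/omegaE; rewrite ?zx.
  have [x' [Cx' dE _]] := dist_attained ball_compact L_continuous L_fix (of_coord e y).
  have [q qx] := surj x'.
  have /pP : fixed q by apply/fixedE; rewrite qx.
  rewrite sq_lt qx -dE zx => H.
  apply: le_lt_trans (dist_le ball_compact L_continuous L_fix x fp) _.
  apply: lt_le_trans H _; rewrite ler_pM2l //.
  exact: (Phi_ub ball_compact L_continuous L_fix Oy).
move=> PP.
(* On an empty set [Phi] would be 0, and nothing nonnegative lies strictly below [c * 0]. *)
have tn0 : Omega L t r !=set0.
  apply: contrapT => tn0; move: PP; rewrite {2}/Phi asboolF // mulr0 ltNge.
  by rewrite (Phi_ge0 ball_compact L_continuous L_fix).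
have [x [Ox PE _]] := Phi_max ball_compact L_continuous L_fix tn0.
have [y yx] := surj x; exists y; rewrite mul1r; split.
  by apply/omegaE; rewrite ?yx // ltW.
move=> z /(omegaE _ lt0) Oz.
have [x' [Cx' dE _]] := dist_attained ball_compact L_continuous L_fix (of_coord e z).
have [p px] := surj x'; exists p; split; first by apply/fixedE; rewrite px.
move=> q /fixedE fq; rewrite sq_lt px -dE.
apply: le_lt_trans (Phi_ub ball_compact L_continuous L_fix Oz) _.
apply: lt_le_trans PP _; rewrite ler_pM2l // PE yx.
exact: (dist_le ball_compact L_continuous L_fix).
Qed.

(** The formula cuts out a finite union of intervals, which agrees with the comparison for [t > 0],
    hence on a right neighbourhood of 0. *)
Lemma Phi_tame lam c : 0 < lam -> 0 < c -> (forall a : R, 0 <= a -> Omega L a r !=set0) ->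
  (\forall t \near 0^'+, Phi L (lam * t) r < c * Phi L t r) \/
  (\forall t \near 0^'+, ~ (Phi L (lam * t) r < c * Phi L t r)).
Proof.
move=> lam0 c0 On0.
have [s sE] := (omin_line O_omin _).1 (Phi_lt_definable lam c).
have sP t : Phi_lt lam c t <-> exists2 I, I \in s & t \in I.
  have env_t : env (\row_(j < 1) t) 0 = t.
    by rewrite -[0%N]/(nat_of_ord (ord0 : 'I_1)) env_ord mxE.
  have := congr1 (fun A : set 'rV[R]_1 => A (\row_(j < 1) t)) sE.
  by rewrite /= env_t mxE => ->.
have PE t : 0 < t -> (exists2 I, I \in s & t \in I) <->
    Phi L (lam * t) r < c * Phi L t r.
  move=> t0; rewrite -sP; apply: Phi_ltE => //.
  by apply: On0; rewrite mulr_ge0 // ltW.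
have [H|H] := near0_intervals s; [left|right];
  by apply: filterS2 H (nbhs_right_gt (0 : R)) => t + t0; rewrite PE.
Qed.

End DefinablePhi.

(** * Measurability and conclusion *)

(** Monotone functions are Borel measurable, and Borel sets are Caratheodory measurable. *)
Lemma nondecreasing_lebesgue_measurable (R : realType) (D : set R) (f : R -> R) :
  measurable D -> {homo f : x y / x <= y} -> lebesgue_measurable_fun D f.
Proof.
move=> mD f_nd _ Y mY; apply: sub_caratheodory.
exact: (measurable_realfun.nondecreasing_measurable mD f_nd mD).
Qed.

Theorem theorem5p5 (R : realType) (E : normedModType R)
    (ip : {dot E for idfun}) (ip_norm : euclidean_norm ip)
    (d : nat) (e : 'I_d -> E) (e_basis : orthonormal_basis ip e)
    (n : nat) (n_gt0 : (0 < n)%N) (L : 'I_n -> E -> E)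
    (L_continuous : forall i, continuous (L i))
    (L_fix : common_fix L !=set0)
    (L_qne : forall i, quasi_nonexpansive (L i))
    (O : forall m, set (set 'rV[R]_m)) (O_omin : o_minimal O)
    (L_definable : forall i, definable_operator O ip e (L i)) :
  forall B : set E, bounded_set B ->
    jointly_Karamata_regular L B /\
    exists r0 : R, forall r : R, r0 <= r ->
      consistent_error_bound L B (Phi L ^~ r) /\
      (common_fix L <> setT ->
        regularity_function L B (Phi L ^~ r) /\
        exists rho : R, 0 <= rho <= 1 /\ RV0 1 rho (Phi L ^~ r)).
Proof.
have ball_compact := euclidean_ball_compact ip_norm e_basis.
have [c Cc] := L_fix.
move=> B [M [_ BM]].
(* Boundedness gives a norm bound for each radius strictly above [M], hence the shift by 1. *)
have {}BM x : B x -> `|x| <= M + 1 by apply: BM; rewrite ltrDl.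
have On0 r : `|c| <= r -> forall a : R, 0 <= a -> Omega L a r !=set0.
  move=> cr a a0; exists c; split => //; apply: le_trans a0.
  exact/residual_le0.
have Phi_bound r : M + 1 <= r -> consistent_error_bound L B (Phi L ^~ r).
  move=> Mr; split.
  - by move=> t _; exact: Phi_ge0.
  - move=> x Bx; apply: Phi_ub => //; split => //.
    by apply: le_trans Mr; exact: BM.
  - by move=> s t _; exact: Phi_nd.
  - exact: Phi_cvg0.
  - exact: Phi_eq0.
(* If every point is a common fixed point, [Phi] vanishes identically and cannot be regularly
   varying, which requires positive values; the identity, of index 1, is then a regularity
   function. *)
have [CT|CnT] := pselect (common_fix L = setT).
  split.
    exists id; split.
      split => //.
      + by move=> x _; rewrite dist_eq0 ?residual_ge0 // CT.
      + exact: cvg_at_right_filter.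
    exists 1, 1; split; [exact: ltr01|by rewrite ler01 lexx|].
    split=> [x /andP[] //||lam lam0].
      by apply: nondecreasing_lebesgue_measurable.
    rewrite powRr1 ?ltW //; apply: cvg_near_cst.
    apply: filterS (nbhs_right_gt (0 : R)) => x x0.
    by rewrite mulfK // gt_eqF.
  by exists (M + 1) => r Mr; split; [exact: Phi_bound|].
have [x0 Cx0] : exists x, ~ common_fix L x.
  by apply/existsNP => CT; apply: CnT; apply/seteqP; split.
(* The ball of radius [r0] contains [B], a common fixed point [c] and a point [x0] outside [C],
   hence also the segment used for the linear lower bound. *)
pose r0 := Num.max (M + 1) (Num.max `|c| `|x0|).
have res_gt0 : 0 < residual L x0.
  by rewrite ltNge; apply/negP => /residual_le0.
suff main r : r0 <= r -> exists rho : R, 0 <= rho <= 1 /\ RV0 1 rho (Phi L ^~ r).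
  have reg r : r0 <= r -> regularity_function L B (Phi L ^~ r).
    move=> r0r; split.
      by apply: Phi_bound; apply: le_trans r0r; rewrite le_max lexx.
    by have [rho [rho01 fRV]] := main r r0r; exists 1, rho.
  split; first by exists (Phi L ^~ r0); exact: reg.
  exists r0 => r r0r; split; first by have [] := reg r r0r.
  by move=> _; split; [exact: reg|exact: main].
rewrite /r0 !ge_max => /and3P[_ cr x0r].
have lb := Phi_linear_lb ball_compact L_continuous L_fix L_qne Cx0 Cc x0r cr.
have Phi_nd_r := Phi_nd ball_compact L_continuous L_fix r.
have Phi_gt0 x : 0 < x -> 0 < Phi L x r.
  (* The linear bound is available only up to [residual L x0]; beyond that value, monotonicity
     propagates positivity. *)
  move=> x_gt0; pose a := Num.min x (residual L x0).
  have a0 : 0 < a by rewrite lt_min x_gt0.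
  apply: (@lt_le_trans _ _ (a / 2)); first exact: divr_gt0.
  apply: (@le_trans _ _ (Phi L a r)).
    by apply: lb; rewrite ltW //= ge_min lexx orbT.
  by apply: Phi_nd_r; rewrite ge_min lexx.
have Phi_lin : \forall x \near (0 : R)^'+, 2^-1 * x <= Phi L x r.
  apply/near0P; exists (residual L x0) => // x /andP[x_gt0 xx0].
  by rewrite mulrC lb // !ltW.
have tame (lam t : R) : 0 < lam <= 1 -> 0 < t ->
    (\forall x \near 0^'+, Phi L (lam * x) r < t * Phi L x r) \/
    (\forall x \near 0^'+, ~ (Phi L (lam * x) r < t * Phi L x r)).
  move=> /andP[lam0 _] t0.
  apply: (Phi_tame ip_norm e_basis L_continuous L_fix O_omin L_definable) => //.
    exact: le_trans cr.
  exact: On0.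
have half_gt0 : 0 < (2^-1 : R) by rewrite invr_gt0.
have [rho [rho01 fRV]] :=
  regular_variation_index Phi_gt0 Phi_nd_r half_gt0 Phi_lin tame.
(* Positivity holds at every [x > 0], in particular on the whole of (0, 1]. *)
exists rho; split=> //; split=> //; first by move=> x /andP[/Phi_gt0].
exact: nondecreasing_lebesgue_measurable.
Qed.
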